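(* Let $n\ge 0$ and let $[S,T]$ be an interval of $\mathrm{Tam}_{n+1}$. Then $[S,T]$ is a new interval if and only if there is an interval $[S_1,T_1]$ in $\mathrm{Tam}_n$ such that $S=Y\circ_1 S_1$ and $T=Y\circ_2 T_1$, where $Y$ is the unique binary tree of size $1$.
   Context: **Binary trees and the Tamari lattice.** A (planar) binary tree of size $n$ is a rooted planar tree with $n$ inner vertices, each having a left child and a right child (each child is an inner vertex or a leaf); it has $n+1$ leaves, labelled $1,\dots,n+1$ from left to right (for $n=0$: a single leaf). Write $X\wedge Z$ for the tree whose root has left subtree $X$ and right subtree $Z$. $\mathrm{Tam}_n$ is the set of binary trees of size $n$, ordered by the reflexive transitive closure of the covering relation in which a tree is covered by any tree obtained from it by replacing one subtree of the form $(A\wedge B)\wedge C$ by $A\wedge(B\wedge C)$. An interval $[S,T]$ is given by a pair $S\le T$. **Grafting and new intervals.** For $T\in\mathrm{Tam}_p$, $S\in\mathrm{Tam}_q$ and $1\le i\le p+1$, $T\circ_i S\in\mathrm{Tam}_{p+q}$ is the tree obtained by grafting the root of $S$ on the $i$-th leaf of $T$. The $i$-th grafting of the interval $[S_2,T_2]$ on $[S_1,T_1]$ is the interval $[S_1\circ_i S_2,\,T_1\circ_i T_2]$. An interval is new if it cannot be obtained as the grafting of two intervals (of trees of sizes $p,q\ge 1$). *)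

(* Defs.v *)
From mathcomp Require Import all_boot.
From Stdlib Require Export Relation_Operators.

Set Implicit Arguments.
Unset Strict Implicit.
Unset Printing Implicit Defensive.

(* Planar binary trees; [Node X Z] is the tree written X /\ Z, whose root has
   left subtree X and right subtree Z. *)
Inductive btree : Type := Leaf | Node of btree & btree.

Fixpoint bsize (t : btree) : nat :=
  if t is Node l r then (bsize l + bsize r).+1 else 0.

(* One step of the rotation (A /\ B) /\ C ~> A /\ (B /\ C), applied to an
   arbitrary subtree. *)
Inductive tam_cover : btree -> btree -> Prop :=
| tam_rot A B C : tam_cover (Node (Node A B) C) (Node A (Node B C))
| tam_cover_left l l' r : tam_cover l l' -> tam_cover (Node l r) (Node l' r)
| tam_cover_right l r r' : tam_cover r r' -> tam_cover (Node l r) (Node l r').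

Definition tam_le : btree -> btree -> Prop := clos_refl_trans btree tam_cover.

Definition in_Tam (n : nat) (t : btree) : Prop := bsize t = n.

Definition tam_interval (n : nat) (S T : btree) : Prop :=
  [/\ in_Tam n S, in_Tam n T & tam_le S T].

(* [graft T i S] is T o_i S. Leaves are numbered from 1, left to right; a tree
   of size p has p + 1 leaves, so the left subtree l of a node carries the
   leaves 1, ..., bsize l + 1. When i is not in 1, ..., bsize T + 1, the tree T
   is returned unchanged. *)
Fixpoint graft (T : btree) (i : nat) (S : btree) : btree :=
  match T with
  | Leaf => if i == 1 then S else Leaf
  | Node l r =>
      if i <= (bsize l).+1 then Node (graft l i S) r
      else Node l (graft r (i - (bsize l).+1) S)
  end.

Definition is_grafting (S T : btree) : Prop :=
  exists p q i S1 T1 S2 T2,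
    [/\ 1 <= p, 1 <= q & 1 <= i <= p.+1] /\
    [/\ tam_interval p S1 T1, tam_interval q S2 T2,
        S = graft S1 i S2 & T = graft T1 i T2].

Definition new_interval (n : nat) (S T : btree) : Prop :=
  tam_interval n S T /\ ~ is_grafting S T.

Definition treeY : btree := Node Leaf Leaf.

Lemma in_Tam1P (t : btree) : in_Tam 1 t <-> t = treeY.
Proof.
by split=> [|->]; case: t => [|[|? ?] [|? ?]] //; rewrite /in_Tam /= ?addnS.
Qed.

Lemma in_Tam_graft (p q i : nat) (T S : btree) :
  in_Tam p T -> in_Tam q S -> 1 <= i <= p.+1 -> in_Tam (p + q) (graft T i S).
Proof.
rewrite /in_Tam => <- <- {p q}.
elim: T i => [|l IHl r IHr] i /= /andP[i_gt0 le_i].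
  by rewrite eqn_leq le_i i_gt0.
case: leqP => [le_il | lt_li] /=.
  by rewrite IHl ?i_gt0 // addSn addnAC.
rewrite IHr ?subn_gt0 ?lt_li ?addSn ?addnA //=.
by rewrite leq_subLR addSn addnS.
Qed.

(* Main.v *)
Require Import Defs.
From mathcomp Require Import all_boot.
From mathcomp Require Import zify.

(** Number the inner vertices of a tree of size N in infix order by
    0, ..., N - 1, and its leaves by 1, ..., N + 1 as [graft] does. Any subtree
    is carried by a set of consecutive vertices. Write R(v) and L(v) for the
    numbers of vertices in the right and left subtrees of v ([rext], [lext]).

    The proof rests on two facts.
    - The Tamari order is the pointwise order of the vectors R ([tam_leP],
      Huang and Tamari), and S <= T makes L decrease pointwise
      ([tam_le_lext]).
    - An interval [S, T] is a grafting as soon as S and T have subtrees on the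
      same leaves, of size strictly between 0 and N
      ([common_subtree_grafting]). The comparisons S1 <= T1 and S2 <= T2
      are automatic: by [tam_leP] they are comparisons of vectors R, and
      grafting acts on these in an explicit and monotone way.

    Suppose that [S, T] is new. If the right subtree of the root r of S were
    not a leaf, it would consist of all the vertices after r; since R(r) is at
    least as large in T, the right subtree of r in T would be the same set, a
    common subtree. So the right subtree of S is a leaf, and symmetrically,
    using L, so is the left subtree of T ([new_shape]): S = S1 /\ Leaf and
    T = Leaf /\ T1. Vertex v of T1 being vertex v + 1 of T, the inequality
    S1 <= T1 says that R_S(v) <= R_T(v + 1), which is [rext_shift]. If
    it failed, put a = R_S(v) > R_T(v + 1). Vertex v + 1 lies in the right
    subtree of v in T, at the bottom of its left spine; climbing this spine,
    either one meets a subtree of size exactly a, which is also the right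
    subtree of v in S, or the size jumps over a at a vertex w whose left subtree
    is v + 1, ..., w - 1. In the latter case w lies in the right subtree of v in
    S, and L_T(w) <= L_S(w) forces w to have the same left subtree in S. Both
    cases give a common subtree.

    Conversely let S = S1 /\ Leaf and T = Leaf /\ T1 with S1 <= T1, and
    suppose that they have a common grafted subtree of size q, with first
    vertex j. The root of T is its vertex 0, so j > 0. In S the vertex j - 1 has
    the whole grafted subtree on its right, so R_S(j - 1) >= q, whereas
    R_T(j) < q because j belongs to the grafted subtree of T; this contradicts
    R_S(j - 1) <= R_T(j), which is S1 <= T1 at vertex j - 1
    ([shifted_not_grafting]). *)

Set Implicit Arguments.
Unset Strict Implicit.
Unset Printing Implicit Defensive.

(** * Left and right extents *)

(** The entries of the bracket vector of the tree; vertices outside the tree get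
    the value 0. *)
Fixpoint rext (t : btree) (v : nat) : nat :=
  if t is Node l r then
    if v < bsize l then rext l v
    else if v == bsize l then bsize r
    else rext r (v - (bsize l).+1)
  else 0.

Fixpoint lext (t : btree) (v : nat) : nat :=
  if t is Node l r then
    if v < bsize l then lext l v
    else if v == bsize l then bsize l
    else lext r (v - (bsize l).+1)
  else 0.

Lemma rext_bound t v : v < bsize t -> v + rext t v < bsize t.
Proof.
elim: t v => //= l IHl r IHr v lt_v.
case: (ltnP v (bsize l)) => [lt_vl|le_v]; first by have := IHl v lt_vl; lia.
case: eqP => [|neq_v]; first by lia.
by have := IHr (v - (bsize l).+1); lia.
Qed.

Lemma lext_bound t v : v < bsize t -> lext t v <= v.
Proof.
elim: t v => //= l IHl r IHr v lt_v.
case: (ltnP v (bsize l)) => [lt_vl|le_v]; first by have := IHl v lt_vl; lia.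
case: eqP => [|neq_v]; first by lia.
by have := IHr (v - (bsize l).+1); lia.
Qed.

(** The left subtree of a vertex u in the right subtree of v cannot reach back
    to v. *)
Lemma lext_right_subtree t v u :
  v < u <= v + rext t v -> u < bsize t -> lext t u <= u - v.+1.
Proof.
elim: t v u => //= l IHl r IHr v u.
case: (ltnP v (bsize l)) => [lt_v|le_v].
  have := rext_bound lt_v => bd /andP[lt_vu le_u] _.
  by rewrite ifT; [apply: IHl; lia|lia].
case: eqP => [->|neq_v] /andP[lt_vu le_u] lt_u; rewrite ifF 1?ifF; try lia.
  by apply: lext_bound; lia.
by have := IHr (v - (bsize l).+1) (u - (bsize l).+1); lia.
Qed.

(** * The Tamari order as the pointwise order of right extents *)

Definition rext_le (S T : btree) : Prop :=
  bsize S = bsize T /\ forall v, v < bsize S -> rext S v <= rext T v.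

Lemma tam_cover_size S T : tam_cover S T -> bsize S = bsize T.
Proof. by elim=> /=; lia. Qed.

(** In the rotation of (A /\ B) /\ C the only vertex whose right extent changes
    is the one between A and B, which gains C and the vertex above C. *)
Lemma tam_cover_rext S T v : tam_cover S T -> rext S v <= rext T v.
Proof.
move=> cov; elim: cov v => [A B C|l l' r cov IH|l r r' cov IH] v /=.
- have -> : v - (bsize A).+1 - (bsize B).+1 = v - (bsize A + bsize B).+2 by lia.
  by do ![case: ifP] => //; lia.
- by rewrite (tam_cover_size cov); do ![case: ifP].
- by rewrite (tam_cover_size cov); do ![case: ifP].
Qed.

(** Dually, only the vertex between B and C changes its left extent: it loses A
    and the vertex between A and B. *)
Lemma tam_cover_lext S T v : tam_cover S T -> lext T v <= lext S v.
Proof.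
move=> cov; elim: cov v => [A B C|l l' r cov IH|l r r' cov IH] v /=.
- have -> : v - (bsize A).+1 - (bsize B).+1 = v - (bsize A + bsize B).+2 by lia.
  by do ![case: ifP] => //; lia.
- by rewrite (tam_cover_size cov); do ![case: ifP].
- by do ![case: ifP].
Qed.

Lemma tam_le_lext S T v : tam_le S T -> lext T v <= lext S v.
Proof.
elim=> [x y /tam_cover_lext//|//|x y z _ le_xy _ le_yz].
exact: leq_trans le_yz le_xy.
Qed.

Lemma tam_le_node l l' r r' :
  tam_le l l' -> tam_le r r' -> tam_le (Node l r) (Node l' r').
Proof.
move=> le_l le_r; apply: (rt_trans _ _ _ (Node l' r)).
  elim: le_l => [x y ?|x|x y z _ ? _ ?].
  - by apply: rt_step; apply: tam_cover_left.
  - exact: rt_refl.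
  - exact: rt_trans (Node y r) _ _ _.
elim: le_r => [x y ?|x|x y z _ ? _ ?].
- by apply: rt_step; apply: tam_cover_right.
- exact: rt_refl.
- exact: rt_trans (Node l' y) _ _ _.
Qed.

(** A vertex k whose right subtree runs to the end of T lies on the right spine of
    T; rotating down the spine vertices above it turns T into a smaller tree with
    root k. This is the greatest such tree below T: the right extents of the
    vertices before k are only truncated so as not to reach k. The third clause
    states this truncation as a lower bound, to be read with e the right extent
    of v in another tree whose root is k. *)
Lemma right_spine_split T k :
  k < bsize T -> (k + rext T k).+1 = bsize T ->
  exists X Z, [/\ bsize X = k, tam_le (Node X Z) T,
    forall v e, v + e < k -> e <= rext T v -> e <= rext X v
    & forall v, rext Z v = rext T (k.+1 + v)].
Proof.
elim: T k => //= C _ D IHD k lt_k.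
case: (ltngtP k (bsize C)) => [lt_kC|lt_Ck|-> _].
- by have := rext_bound lt_kC; lia.
- move=> spine.
  have [||X [Z [szX le_XZ rX rZ]]] := IHD (k - (bsize C).+1); [lia|lia|].
  exists (Node C X), Z; split.
  + by rewrite /= szX; lia.
  + apply: (rt_trans _ _ _ (Node C (Node X Z))).
      by apply: rt_step; apply: tam_rot.
    by apply: tam_le_node => //; apply: rt_refl.
  + move=> v e lt_ve /=; case: (ltnP v (bsize C)) => // le_v.
    case: eqP => [|neq_v]; first by lia.
    by apply: rX; lia.
  + by move=> v; rewrite rZ ifF ?ifF; [congr rext|..]; lia.
- exists C, D; split=> //; first exact: rt_refl.
    by move=> v e lt_ve; rewrite ifT //; lia.
  by move=> v; rewrite ifF ?ifF; [congr rext|..]; lia.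
Qed.

(** For the converse direction, the right extent of the root of S is the largest
    possible, so this vertex lies on the right spine of T. By
    [right_spine_split], T can be replaced by a smaller tree with the same root
    vertex as S, and the left and right subtrees are compared by induction. *)
Lemma tam_leP S T : tam_le S T <-> rext_le S T.
Proof.
split.
  elim=> [x y cov|x|x y z _ [sz1 le1] _ [sz2 le2]].
  - split; first exact: tam_cover_size.
    by move=> v _; apply: tam_cover_rext.
  - by [].
  - split; first by rewrite sz1.
    by move=> v lt_v; apply: leq_trans (le1 v lt_v) (le2 v _); rewrite -sz1.
elim: S T => [|A IHA B IHB] T [/= szT le_T].
  by case: T szT {le_T} => //= _; apply: rt_refl.
have lt_A : bsize A < bsize T by lia.
have := le_T (bsize A); rewrite ltnn eqxx => /(_ ltac:(lia)) rA.
have [|X [Z [szX le_XZ rX rZ]]] := right_spine_split lt_A.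
  by have := rext_bound lt_A; lia.
have szXZ : bsize (Node X Z) = bsize T.
  by elim: le_XZ => [x y /tam_cover_size||x y z _ -> _].
apply: rt_trans le_XZ; apply: tam_le_node.
  apply: IHA; split=> // v lt_v; apply: rX; first exact: rext_bound.
  by have := le_T v; rewrite lt_v; apply; lia.
apply: IHB; split=> [|v lt_v]; first by move: szXZ => /=; lia.
rewrite rZ; have := le_T ((bsize A).+1 + v).
by rewrite ifF ?ifF ?addKn; [apply|..]; lia.
Qed.

(** * Right extents of a grafting *)

Lemma bsize_graft T i S :
  0 < i <= (bsize T).+1 -> bsize (graft T i S) = bsize T + bsize S.
Proof. exact: in_Tam_graft. Qed.

(** Grafting S on leaf i places the vertices of S at i - 1, ..., i + bsize S - 2;
    those of T before that keep their number, and the others are shifted by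
    bsize S. *)
Lemma rext_graft_in T i S v : 0 < i <= (bsize T).+1 -> v < bsize S ->
  rext (graft T i S) (i.-1 + v) = rext S v.
Proof.
elim: T i => [|l IHl r IHr] i /= hi lt_v.
  by have -> : i = 1 by lia.
case: ifP => hil /=.
  by rewrite bsize_graft ?ifT ?IHl //; lia.
rewrite ifF ?ifF; try lia.
rewrite -[RHS](IHr (i - (bsize l).+1)) //; last by lia.
by congr rext; lia.
Qed.

Lemma rext_graft_after T i S v : 0 < i <= v.+1 -> v < bsize T ->
  rext (graft T i S) (v + bsize S) = rext T v.
Proof.
elim: T i v => [|l IHl r IHr] i v //= hi lt_v.
case: ifP => hil /=.
  rewrite bsize_graft; last by lia.
  rewrite ltn_add2r eqn_add2r; case: (ltnP v (bsize l)) => hv.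
    by rewrite IHl //; lia.
  by case: eqP => // hv'; congr rext; lia.
rewrite !ifF; try lia.
by rewrite -(IHr (i - (bsize l).+1)); [congr rext|..]; lia.
Qed.

(** The right subtree of v carries the leaves v + 2, ..., v + rext T v + 2, and
    it gains the vertices of S exactly when leaf i is one of them. *)
Lemma rext_graft_before T i S v : v.+1 < i <= (bsize T).+1 ->
  rext (graft T i S) v =
    rext T v + (if i <= (v + rext T v).+2 then bsize S else 0).
Proof.
elim: T i v => [|l IHl r IHr] i v /= hi; first by lia.
case: ifP => hil /=.
  rewrite bsize_graft; last by lia.
  rewrite ifT; last by lia.
  by rewrite ifT; [rewrite IHl //|]; lia.
case: (ltnP v (bsize l)) => hv.
  by have bd := rext_bound hv; rewrite [X in _ + X]ifF ?addn0 //; lia.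
case: eqP => hv'.
  by rewrite bsize_graft ?ifT; lia.
rewrite IHr; last by lia.
by congr (_ + _); do 2!case: ifP; lia.
Qed.

(** The right extents of each component can be recovered from those of the
    grafting; for the vertices before the grafted tree this uses that
    e |-> e + (if i <= v + e + 2 then q else 0) is strictly increasing. *)
Lemma rext_le_graft S1 S2 T1 T2 i :
  bsize S1 = bsize T1 -> bsize S2 = bsize T2 -> 0 < i <= (bsize T1).+1 ->
  rext_le (graft S1 i S2) (graft T1 i T2) -> rext_le S1 T1 /\ rext_le S2 T2.
Proof.
move=> sz1 sz2 hi [_ le_ST].
have szS : bsize (graft S1 i S2) = bsize S1 + bsize S2.
  by rewrite bsize_graft ?sz1.
split; split=> // v lt_v.
  case: (ltnP v.+1 i) => hv.
    have := le_ST v; rewrite szS !rext_graft_before ?sz1; try lia.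
    by rewrite sz2; do 2!case: ifP; lia.
  have := le_ST (v + bsize S2).
  by rewrite szS rext_graft_after ?sz2 ?rext_graft_after; lia.
have := le_ST (i.-1 + v).
by rewrite szS !rext_graft_in -?sz2 ?sz1 //; lia.
Qed.

(** * Common subtrees and graftings *)

(** A subtree of size q whose first leaf is leaf i of T. Stated as a grafting, so
    that it does not matter whether the subtree is a left or a right child. *)
Definition subtree_at (T : btree) (i q : nat) : Prop :=
  exists T1 T2, [/\ T = graft T1 i T2, bsize T2 = q,
    bsize T1 + q = bsize T & 0 < i <= (bsize T1).+1].

Lemma subtree_left l r i q :
  subtree_at l i q -> subtree_at (Node l r) i q.
Proof.
move=> [l1 [l2 [-> szq szl hi]]]; exists (Node l1 r), l2.
by split=> //=; [rewrite ifT//|rewrite bsize_graft|]; lia.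
Qed.

Lemma subtree_right l r i q :
  subtree_at r i q -> subtree_at (Node l r) ((bsize l).+1 + i) q.
Proof.
move=> [r1 [r2 [-> szq szr hi]]]; exists (Node l r1), r2.
by split=> //=; [rewrite ifF ?addKn//|rewrite bsize_graft|]; lia.
Qed.

Lemma subtree_self t : subtree_at t 1 (bsize t).
Proof. by exists Leaf, t. Qed.

Lemma subtree_rext t v : v < bsize t -> subtree_at t v.+2 (rext t v).
Proof.
elim: t v => //= l IHl r IHr v lt_v.
case: (ltnP v (bsize l)) => [lt_vl|le_v]; first exact: subtree_left (IHl v lt_vl).
case: eqP => [->|neq_v].
  by have := subtree_right l (subtree_self r); rewrite addn1.
have := subtree_right l (IHr (v - (bsize l).+1) _).
have -> : (bsize l).+1 + (v - (bsize l).+1).+2 = v.+2 by lia.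
by apply; lia.
Qed.

Lemma subtree_lext t v : v < bsize t -> subtree_at t (v - lext t v).+1 (lext t v).
Proof.
elim: t v => //= l IHl r IHr v lt_v.
case: (ltnP v (bsize l)) => [lt_vl|le_v]; first exact: subtree_left (IHl v lt_vl).
case: eqP => [->|neq_v].
  by rewrite subnn; apply: subtree_left; apply: subtree_self.
have lt_v' : v - (bsize l).+1 < bsize r by lia.
have := subtree_right l (IHr _ lt_v'); have := lext_bound lt_v'.
set e := lext r _ => le_e.
by have -> : (bsize l).+1 + (v - (bsize l).+1 - e).+1 = (v - e).+1 by lia.
Qed.

(** Sharing the leaves of one subtree is enough: the order on both components
    comes for free from [rext_le_graft]. *)
Lemma common_subtree_grafting S T i q :
  tam_le S T -> subtree_at S i q -> subtree_at T i q -> 0 < q < bsize S ->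
  is_grafting S T.
Proof.
move=> /tam_leP le_ST [S1 [S2 [eS szS2 szS hi]]] [T1 [T2 [eT szT2 szT _]]] hq.
have szST := le_ST.1; rewrite {}eS {}eT in le_ST szS szT szST hq *.
have [|||/tam_leP le1 /tam_leP le2] := rext_le_graft _ _ _ le_ST; try lia.
exists (bsize S1), q, i, S1, T1, S2, T2.
have szST1 : bsize S1 = bsize T1 by lia.
by split; split=> //; try lia; split.
Qed.

(** * Shape of the new intervals *)

(** Climb the left spine of t from vertex 0 up to the first subtree of size
    greater than a: either its root w has a nonempty left subtree, which consists
    of all the vertices before w and has size at most a, or its root is vertex 0
    itself. *)
Lemma left_spine_cases t a : 0 < a < bsize t ->
  (exists w, 0 < w <= a /\ lext t w = w) \/ a <= rext t 0.
Proof.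
elim: t a => [|l IHl r _] a /= ha; first by lia.
case: (posnP (bsize l)) => [l0|l_gt0]; first by right; rewrite l0 eqxx; lia.
case: (ltnP a (bsize l)) => ha'.
  have [|[w [hw ew]]|] := IHl a; [by lia| |by right].
  by left; exists w; split=> //; rewrite ifT //; lia.
by left; exists (bsize l); rewrite ltnn eqxx; lia.
Qed.

(** [left_spine_cases] inside the right subtree of v, whose first vertex
    is v + 1. *)
Lemma right_subtree_cases t v a : v < bsize t -> 0 < a < rext t v ->
  (exists w, 0 < w <= a /\ lext t (v.+1 + w) = w) \/ a <= rext t v.+1.
Proof.
elim: t v => [|l IHl r IHr] v //= lt_v.
case: (ltnP v (bsize l)) => [lt_vl|le_v].
  have := rext_bound lt_vl => bd ha.
  have [[w [hw ew]]|] := IHl v lt_vl ha.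
    by left; exists w; split=> //; rewrite ifT //; lia.
  by right; rewrite ifT //; lia.
case: eqP => [->|neq_v] ha.
  have [[w [hw ew]]|] := left_spine_cases ha.
    left; exists w; split=> //; rewrite ifF ?ifF; try lia.
    by rewrite addKn.
  by right; rewrite ifF ?ifF ?subnn; lia.
have [|[w [hw ew]]|le_a] := IHr (v - (bsize l).+1) _ ha; first by lia.
  left; exists w; split=> //; rewrite ifF ?ifF; try lia.
  by rewrite -[RHS]ew; congr lext; lia.
right; rewrite ifF ?ifF; try lia.
by have -> : v.+1 - (bsize l).+1 = (v - (bsize l).+1).+1 by lia.
Qed.

(** If R_S(v) exceeded R_T(v + 1), the right subtree of v in S, or the left
    subtree of a vertex inside it, would also be a subtree of T. All these
    candidates start at leaf v + 2, so that only their sizes have to be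
    matched. *)
Lemma rext_shift S T v : tam_le S T -> ~ is_grafting S T ->
  v < bsize S -> rext S v <= rext T v.+1.
Proof.
move=> le_ST not_graft lt_v; have [szST rST] := (tam_leP S T).1 le_ST.
rewrite leqNgt; apply/negP => lt_T; set a := rext S v in lt_T.
have bdS := rext_bound lt_v; rewrite -/a in bdS.
have lt_vT : v < bsize T by rewrite -szST.
case: (ltngtP a (rext T v)) => [lt_a|lt_a|eq_a].
- have [|[w [hw ew]]|] := @right_subtree_cases T v a lt_vT; [by lia| |by lia].
  have bdT := rext_bound lt_vT.
  have lt_wT : v.+1 + w < bsize T by lia.
  have subT := subtree_lext lt_wT; rewrite ew addnK in subT.
  apply: not_graft; case: (ltngtP w a) => [lt_wa|lt_wa|eq_wa]; [|by lia|].
  (* The vertex v + 1 + w is in the right subtree of v in S, which bounds its left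
     extent there by w; the order bounds it from below by w. *)
  + have lt_wS : v.+1 + w < bsize S by lia.
    have ewS : lext S (v.+1 + w) = w.
      have := @lext_right_subtree S v (v.+1 + w).
      have := tam_le_lext (v.+1 + w) le_ST.
      by rewrite ew -/a; lia.
    have subS := subtree_lext lt_wS; rewrite ewS addnK in subS.
    by apply: common_subtree_grafting le_ST subS subT _; lia.
  (* Here a left subtree in T matches the whole right subtree of v in S. *)
  + have subS := subtree_rext lt_v; rewrite -/a -eq_wa in subS.
    by apply: common_subtree_grafting le_ST subS subT _; lia.
- by have := rST v lt_v; rewrite -/a; lia.
- have := subtree_rext lt_vT; rewrite -eq_a => subT; apply: not_graft.
  by apply: common_subtree_grafting le_ST (subtree_rext lt_v) subT _; lia.
Qed.

(** The right subtree of the root of S, and the left subtree of the root of T,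
    reach an extremal leaf; the order then forces the same subtree in the other
    tree, where its extent can be neither larger nor smaller. *)
Lemma new_shape S T : tam_le S T -> ~ is_grafting S T -> 0 < bsize S ->
  exists S1 T1, S = Node S1 Leaf /\ T = Node Leaf T1.
Proof.
case: S T => [|A B] [|C D] // le_ST not_graft _.
  by have [] := (tam_leP _ _).1 le_ST.
have [/= szST rST] := (tam_leP _ _).1 le_ST.
have eB : bsize B = 0.
  apply/eqP; rewrite -leqn0 leqNgt; apply/negP => B_gt0; apply: not_graft.
  have lt_A : bsize A < bsize (Node C D) by rewrite /=; lia.
  have eT : rext (Node C D) (bsize A) = bsize B.
    have := rST (bsize A); have /= := rext_bound lt_A.
    by rewrite ltnn eqxx; lia.
  have := subtree_rext lt_A; rewrite eT => subT.
  have := subtree_right A (subtree_self B); rewrite addn1 => subS.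
  by apply: common_subtree_grafting le_ST subS subT _ => /=; lia.
have eC : bsize C = 0.
  apply/eqP; rewrite -leqn0 leqNgt; apply/negP => C_gt0; apply: not_graft.
  have lt_C : bsize C < bsize (Node A B) by rewrite /=; lia.
  have eS : lext (Node A B) (bsize C) = bsize C.
    have := tam_le_lext (bsize C) le_ST; have := lext_bound lt_C.
    by rewrite [lext (Node C D) _]/= ltnn eqxx; lia.
  have := subtree_lext lt_C; rewrite eS subnn => subS.
  have subT := subtree_left D (subtree_self C).
  by apply: common_subtree_grafting le_ST subS subT _ => /=; lia.
by case: B C eB eC {le_ST not_graft szST rST} => [|? ?] [|? ?] //; exists A, D.
Qed.

(** The contradiction is read at the vertex i - 2 of S1, just before the grafted
    tree: in S its right subtree contains all of the grafted tree, while the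
    corresponding vertex i - 1 of T is the first one of the grafted tree. *)
Lemma shifted_not_grafting S1 T1 :
  tam_le S1 T1 -> ~ is_grafting (Node S1 Leaf) (Node Leaf T1).
Proof.
move=> /tam_leP [sz le1] [p [q [i [A [A' [B [B' [[hp hq hi] [iA iB eS eT]]]]]]]]].
have [szA szA' _] := iA; have [szB szB' _] := iB.
rewrite /in_Tam in szA szA' szB szB'.
have szT : bsize (Node Leaf T1) = p + q by rewrite eT bsize_graft ?szA' ?szB'.
rewrite /= add0n in szT.
have B'0 : rext B' 0 < q by rewrite -szB' -[rext _ _]add0n rext_bound ?szB'.
have eB' : rext (Node Leaf T1) i.-1 = rext B' 0.
  by rewrite eT -[i.-1]addn0 rext_graft_in ?szA' ?szB'.
case: (ltnP 1 i) => hi1; last first.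
  (* With i = 1, vertex 0, the root of T, would be a vertex of B'. *)
  have ei : i = 1 by lia.
  by move: eB'; rewrite ei /=; lia.
have := le1 i.-2; have := @rext_graft_before A i B i.-2.
rewrite -eS szA szB ifT /=; last by lia.
rewrite ifT; last by lia.
move=> /(_ ltac:(lia)) ->; move: eB' => /=.
rewrite ifF; last by lia.
have -> : i.-1 - 1 = i.-2 by lia.
by lia.
Qed.

Theorem theorem4p18 (n : nat) (S T : btree) (hST : tam_interval n.+1 S T) :
  new_interval n.+1 S T <->
  exists S1 T1 : btree,
    [/\ tam_interval n S1 T1, S = graft treeY 1 S1 & T = graft treeY 2 T1].
Proof.
have [szS szT le_ST] := hST; split=> [[_ not_graft]|[S1 [T1 [[_ _ le1] eS eT]]]].
  have [|S1 [T1 [eS eT]]] := new_shape le_ST not_graft; first by rewrite szS.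
  have shift v := @rext_shift S T v le_ST not_graft.
  exists S1, T1; split=> //; rewrite {}eS {}eT /in_Tam /= in szS szT shift *.
  have szS1 : bsize S1 = n by lia.
  have szT1 : bsize T1 = n by lia.
  split=> //; apply/tam_leP; split=> [|v lt_v]; first by rewrite szS1.
  by have := shift v; rewrite lt_v subn1 /=; apply; lia.
split=> //; rewrite eS eT; exact: shifted_not_grafting.
Qed.
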